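(* The four orientation rules R1, R2, R3, R4 are sound. That is, for each $i\in\{1,2,3,4\}$: if $G$ is a partially directed graph in which the premise of rule R$i$ is satisfied by some vertices, and $H$ is any directed graph that extends $G$ and in which the undirected edge that R$i$ would orient has the orientation opposite to the one indicated by R$i$, then $H$ contains a directed cycle or a new unshielded collider, i.e. an unshielded collider of $H$ that is not an unshielded collider of $G$.
   Context: All graphs are finite. A partially directed graph is a graph that may have both undirected edges ($A-B$) and directed edges ($A\to B$), with at most one edge between any pair of (distinct) vertices. It is directed if it has no undirected edges. Two vertices are adjacent if they are joined by an edge of either kind. A partially directed graph $G$ extends a partially directed graph $H$ if they have the same vertices and adjacencies and every directed edge $A\to B$ of $H$ is a directed edge $A\to B$ of $G$. A triple $\langle A,B,C\rangle$ of distinct vertices is an unshielded collider in $G$ if $A\to B$ and $C\to B$ are in $G$ and $A$ is not adjacent to $C$. Orientation rules (in each rule the named vertices are distinct): R1: if $X\to Y$, $Y-Z$, and $X,Z$ are not adjacent, then orient $Y\to Z$. R2: if $X\to Y$, $Y\to Z$ and $X-Z$, then orient $X\to Z$. R3: if $X-Y$, $X-Z$, $X-W$, $Y\to W$, $Z\to W$, and $Y,Z$ are not adjacent, then orient $X\to W$. R4: if $X-Y$, $X-W$, $Y\to Z$, $Z\to W$, $X$ and $Z$ are adjacent (by an edge of any kind), and $Y,W$ are not adjacent, then orient $X\to W$. An orientation rule is sound if any orientation of the edge other than the one indicated by the rule would lead to a new unshielded collider or a directed cycle. *)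

(* Defs.v *)
From mathcomp Require Import all_boot.

Set Implicit Arguments.
Unset Strict Implicit.
Unset Printing Implicit Defensive.

(* [und G A B] is A - B and [dir G A B] is A -> B.  The last two fields say that
   a pair of vertices carries at most one edge; A - B together with B -> A is
   excluded by symmetry of [und]. *)
Record pdgraph (V : finType) := PDGraph {
  und : rel V;
  dir : rel V;
  und_sym : symmetric und;
  und_irr : irreflexive und;
  dir_irr : irreflexive dir;
  und_dir : forall A B : V, und A B -> ~~ dir A B;
  dir_asym : forall A B : V, dir A B -> ~~ dir B A
}.

Section PartiallyDirectedGraphs.

Variable V : finType.
Implicit Types G H : pdgraph V.

Definition adjacent G : rel V :=
  fun A B => [|| und G A B, dir G A B | dir G B A].

Definition directed G : Prop := forall A B : V, ~~ und G A B.

(* The extending graph comes first. *)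
Definition extends H G : Prop :=
  (forall A B : V, adjacent H A B = adjacent G A B) /\
  (forall A B : V, dir G A B -> dir H A B).

Definition unshielded_collider G (A B C : V) : bool :=
  [&& uniq [:: A; B; C], dir G A B, dir G C B & ~~ adjacent G A C].

Definition has_directed_cycle G : Prop :=
  exists2 c : seq V, c != [::] & ucycle (dir G) c.

Definition has_new_unshielded_collider H G : Prop :=
  exists A B C : V,
    unshielded_collider H A B C /\ ~~ unshielded_collider G A B C.

(* For a rule R, [R G A B] means that some vertices of G satisfy the premise of
   R in such a way that R orients the undirected edge A - B as A -> B. *)
Definition orientation_rule := pdgraph V -> V -> V -> Prop.

Definition R1 : orientation_rule := fun G Y Z =>
  exists X : V,
    [&& uniq [:: X; Y; Z], dir G X Y, und G Y Z & ~~ adjacent G X Z].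

Definition R2 : orientation_rule := fun G X Z =>
  exists Y : V,
    [&& uniq [:: X; Y; Z], dir G X Y, dir G Y Z & und G X Z].

Definition R3 : orientation_rule := fun G X W =>
  exists Y Z : V,
    [&& uniq [:: X; Y; Z; W], und G X Y, und G X Z, und G X W,
        dir G Y W, dir G Z W & ~~ adjacent G Y Z].

Definition R4 : orientation_rule := fun G X W =>
  exists Y Z : V,
    [&& uniq [:: X; Y; Z; W], und G X Y, und G X W, dir G Y Z,
        dir G Z W, adjacent G X Z & ~~ adjacent G Y W].

Definition sound (R : orientation_rule) : Prop :=
  forall (G H : pdgraph V) (A B : V),
    R G A B -> directed H -> extends H G -> dir H B A ->
    has_directed_cycle H \/ has_new_unshielded_collider H G.

End PartiallyDirectedGraphs.

Arguments R1 {V}.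
Arguments R2 {V}.
Arguments R3 {V}.
Arguments R4 {V}.

(* Main.v *)
(* In the oriented graph the reversed edge closes a directed triangle (R2) or
   creates a collider (R1).  For R3 and R4, acyclicity of triangles through the
   reversed edge W -> X forces Y -> X (and Z -> X), so X becomes the centre of an
   unshielded collider, with sides Y, Z for R3 and Y, W for R4.  Each such
   collider is new because one of its two edges is undirected in G. *)
Require Import Defs.
From mathcomp Require Import all_boot.

Set Implicit Arguments.
Unset Strict Implicit.
Unset Printing Implicit Defensive.

Lemma dir_neq (V : finType) (G : pdgraph V) (A B : V) : dir G A B -> A != B.
Proof. by apply: contraTneq => ->; rewrite dir_irr. Qed.

(** [ucycle] also asks for distinct vertices; this follows from irreflexivity of [dir]. *)
Lemma directed_triangle (V : finType) (G : pdgraph V) (A B C : V) :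
  dir G A B -> dir G B C -> dir G C A -> has_directed_cycle G.
Proof.
move=> AB BC CA; exists [:: A; B; C] => //.
rewrite /ucycle /= AB BC CA !inE negb_or (dir_neq AB) (dir_neq BC).
by rewrite eq_sym (dir_neq CA).
Qed.

(** Stated for [adjacent] rather than [und], since in R4 the edge between [X] and [Z] may be of any
    kind. *)
Lemma extends_orient (V : finType) (G H : pdgraph V) (A B : V) :
  directed H -> extends H G -> adjacent G A B -> dir H A B \/ dir H B A.
Proof.
by move=> dirH [adjH _]; rewrite -adjH /adjacent (negPf (dirH A B)) /= => /orP.
Qed.

Lemma new_collider (V : finType) (G H : pdgraph V) (A B C : V) :
  extends H G -> und G A B -> dir H A B -> dir H C B ->
  A != C -> ~~ adjacent G A C -> has_new_unshielded_collider H G.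
Proof.
move=> [adjH _] uAB AB CB neqAC nadjAC; exists A, B, C; split.
  rewrite /unshielded_collider AB CB adjH nadjAC /= !inE negb_or neqAC.
  by rewrite (dir_neq AB) eq_sym (dir_neq CB).
by rewrite /unshielded_collider (negPf (und_dir uAB)) andbF.
Qed.

Lemma adjacent_sym (V : finType) (G : pdgraph V) : symmetric (adjacent G).
Proof. by move=> A B; rewrite /adjacent und_sym (orbC (dir G A B)). Qed.

Lemma und_adjacent (V : finType) (G : pdgraph V) (A B : V) :
  und G A B -> adjacent G A B.
Proof. by rewrite /adjacent => ->. Qed.

Lemma sound_R1 (V : finType) : sound (@R1 V).
Proof.
move=> G H Y Z [X /and4P[uXYZ XY YZ nXZ]] _ ext ZY; right.
(* The collider is [Z] -> [Y] <- [X], with [Z] first because [Y] - [Z] is the edge undirected in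
   [G]. *)
apply: (new_collider ext _ ZY (ext.2 _ _ XY)).
- by rewrite und_sym.
- by rewrite eq_sym; move: uXYZ; rewrite /= !inE !negb_or => /andP[/andP[]].
- by rewrite adjacent_sym.
Qed.

Lemma sound_R2 (V : finType) : sound (@R2 V).
Proof.
move=> G H X Z [Y /and4P[_ XY YZ _]] _ ext ZX; left.
exact: directed_triangle (ext.2 _ _ XY) (ext.2 _ _ YZ) ZX.
Qed.

Lemma sound_R3 (V : finType) : sound (@R3 V).
Proof.
move=> G H X W [Y [Z /and5P[uniqV XY XZ _ /and3P[YW ZW nYZ]]]] dirH ext WX.
have neqYZ : Y != Z.
  by move: uniqV; rewrite /= !inE !negb_or => /and4P[_ /andP[]].
(* Orienting out of [X] would close a triangle through [W], for [Y] and [Z] alike. *)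
have [XY'|YX] := extends_orient dirH ext (und_adjacent XY).
  by left; exact: directed_triangle XY' (ext.2 _ _ YW) WX.
have [XZ'|ZX] := extends_orient dirH ext (und_adjacent XZ).
  by left; exact: directed_triangle XZ' (ext.2 _ _ ZW) WX.
by right; apply: new_collider ext _ YX ZX neqYZ nYZ; rewrite und_sym.
Qed.

Lemma sound_R4 (V : finType) : sound (@R4 V).
Proof.
move=> G H X W [Y [Z /and5P[uniqV XY _ YZ /and3P[ZW aXZ nYW]]]] dirH ext WX.
have neqYW : Y != W.
  by move: uniqV; rewrite /= !inE !negb_or => /and4P[_ /andP[]].
(* This edge is settled first: the resulting [Z] -> [X] closes the triangle [X] -> [Y] -> [Z] ->
   [X], which excludes [X] -> [Y]. *)
have [XZ|ZX] := extends_orient dirH ext aXZ.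
  by left; exact: directed_triangle XZ (ext.2 _ _ ZW) WX.
have [XY'|YX] := extends_orient dirH ext (und_adjacent XY).
  by left; exact: directed_triangle XY' (ext.2 _ _ YZ) ZX.
by right; apply: new_collider ext _ YX WX neqYW nYW; rewrite und_sym.
Qed.

Theorem theorem2 (V : finType) :
  [/\ sound (@R1 V), sound (@R2 V), sound (@R3 V) & sound (@R4 V)].
Proof.
by split; [exact: sound_R1 | exact: sound_R2 | exact: sound_R3 | exact: sound_R4].
Qed.
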